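(* Suppose that $p_1,p_2,q_1,q_2\in\mathbb{R}$ satisfy $$\max\{p_1^2,p_2^2\}+\max\{q_1^2,q_2^2\}<1,$$ and let $\delta_1,\delta_2,\varepsilon_1,\varepsilon_2\in\{-1,1\}$ be arbitrary signs. Then the formulae $$\begin{aligned} \mathbf{a}_1&=\Bigl(\tfrac{p_1}{\cos\theta},\delta_1\sqrt{1-\tfrac{p_1^2}{\cos^2\theta}},0,0\Bigr),& \mathbf{b}_1&=\Bigl(\tfrac{p_2}{\cos\theta},\delta_2\sqrt{1-\tfrac{p_2^2}{\cos^2\theta}},0,0\Bigr),\\ \mathbf{a}_2&=\Bigl(0,0,\tfrac{q_1}{\sin\theta},\varepsilon_1\sqrt{1-\tfrac{q_1^2}{\sin^2\theta}}\Bigr),& \mathbf{b}_2&=\Bigl(0,0,\tfrac{q_2}{\sin\theta},\varepsilon_2\sqrt{1-\tfrac{q_2^2}{\sin^2\theta}}\Bigr),\\ \mathbf{a}_3&=(\cos\theta,0,\sin\theta,0),&\mathbf{b}_3&=(\cos\theta,0,-\sin\theta,0) \end{aligned}$$ provide a flexion of an octahedron in $\mathbb{S}^3$. The parameter $\theta$ runs over $[\theta_{\min},\theta_{\max}]$ (with $\theta\in(0,\pi/2)$), where $$\theta_{\min}=\arcsin\bigl(\max\{|q_1|,|q_2|\}\bigr),\qquad \theta_{\max}=\arccos\bigl(\max\{|p_1|,|p_2|\}\bigr).$$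
   Context: $\mathbb{S}^3$ is the unit sphere centered at the origin in Euclidean space $\mathbb{E}^4$. An octahedron in $\mathbb{S}^3$ is a (possibly self-intersecting) polyhedral surface with the combinatorial type of a regular octahedron: it has 6 vertices $\mathbf{a}_1,\mathbf{a}_2,\mathbf{a}_3,\mathbf{b}_1,\mathbf{b}_2,\mathbf{b}_3$, 12 edges (shortest great-circle arcs) joining all pairs of vertices except the three pairs $\{\mathbf{a}_i,\mathbf{b}_i\}$, and 8 triangular faces $\mathbf{u}_1\mathbf{u}_2\mathbf{u}_3$ with $\mathbf{u}_i\in\{\mathbf{a}_i,\mathbf{b}_i\}$; all faces are non-degenerate (the vertices of a face do not lie on a great circle). A flexion (flex) is a continuous family of octahedra in which every face remains congruent to itself (equivalently all 12 edge lengths are constant) and which is not induced by a continuous family of isometries of $\mathbb{S}^3$. *)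

(* Defs.v *)
From HB Require Import structures.
From mathcomp Require Import all_boot all_order all_algebra.
From mathcomp Require Import all_classical all_reals all_analysis.
Import Order.TTheory GRing.Theory Num.Theory.
Import numFieldNormedType.Exports.

Set Implicit Arguments.
Unset Strict Implicit.
Unset Printing Implicit Defensive.

Local Open Scope classical_set_scope.
Local Open Scope ring_scope.

Section SphericalGeometry.
Variable R : realType.

Definition dot (x y : 'rV[R]_4) : R := \sum_(i < 4) x ord0 i * y ord0 i.

Definition S3 : set 'rV[R]_4 := [set x | dot x x = 1].

(* The intrinsic (angular) metric of the sphere. *)
Definition sdist (x y : 'rV[R]_4) : R := acos (dot x y).

(* Only the restriction of [f] to [S3] matters. *)
Definition is_isometry (f : 'rV[R]_4 -> 'rV[R]_4) : Prop :=
  f @` S3 = S3 /\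
  forall x y, S3 x -> S3 y -> sdist (f x) (f y) = sdist x y.

Definition great_circle (C : set 'rV[R]_4) : Prop :=
  exists2 A : 'M[R]_(2, 4), \rank A = 2%N & C = [set x | S3 x /\ (x <= A)%MS].

(* [P i false] is the vertex a_(i+1) and [P i true] the vertex b_(i+1), for
   [i = 0, 1, 2].  The surface is determined by its labelled vertices; a_i and
   b_i are allowed to occupy the same point of the sphere. *)
Definition vertices := 'I_3 -> bool -> 'rV[R]_4.

(* The eight faces are indexed by [s : 'I_3 -> bool]: the vertices of the face
   [s] are [face P s i] for [i : 'I_3], so that every edge lies in a face. *)
Definition face (P : vertices) (s : 'I_3 -> bool) : 'I_3 -> 'rV[R]_4 :=
  fun i => P i (s i).

Definition nondegenerate (T : 'I_3 -> 'rV[R]_4) : Prop :=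
  ~ exists2 C, great_circle C & forall i, C (T i).

(* Nondegeneracy of the faces forces the endpoints of each of the twelve edges
   to be neither equal nor antipodal, so that the shortest great-circle arc
   joining them exists and is unique. *)
Definition is_octahedron (P : vertices) : Prop :=
  (forall i b, S3 (P i b)) /\ (forall s, nondegenerate (face P s)).

Definition congruent (T T' : 'I_3 -> 'rV[R]_4) : Prop :=
  exists2 f, is_isometry f & forall i, f (T i) = T' i.

(* On isometries of the compact space [S3], pointwise convergence and uniform
   convergence coincide, hence continuity of the family is stated pointwise. *)
Definition continuous_isometries (I : set R)
    (g : R -> 'rV[R]_4 -> 'rV[R]_4) : Prop :=
  (forall t, I t -> is_isometry (g t)) /\
  (forall x, S3 x -> {within I, continuous (fun t => g t x)}).

Definition induced_by_isometries (I : set R) (P : R -> vertices) : Prop :=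
  exists t0 g, [/\ I t0, continuous_isometries I g &
    forall t, I t -> forall i b, P t i b = g t (P t0 i b)].

Definition is_flexion (I : set R) (P : R -> vertices) : Prop :=
  [/\ is_interval I,
      forall t, I t -> is_octahedron (P t),
      forall i b, {within I, continuous (fun t => P t i b)},
      forall s t t', I t -> I t' -> congruent (face (P t) s) (face (P t') s)
    & ~ induced_by_isometries I P].

Definition vec4 (x y z w : R) : 'rV[R]_4 := \row_j [:: x; y; z; w]`_j.

Definition octahedron (a1 b1 a2 b2 a3 b3 : 'rV[R]_4) : vertices :=
  fun i b => if b then [:: b1; b2; b3]`_i else [:: a1; a2; a3]`_i.

End SphericalGeometry.

(* Main.v *)
(* The vertices a_1, b_1 lie in the coordinate plane x_3 = x_4 = 0 and a_2, b_2
   in the orthogonal plane x_1 = x_2 = 0, while a_3, b_3 have coordinates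
   cos theta and +- sin theta along one axis of each plane.  Hence the scalar
   products along the edges are 0, p_i and +- q_i, independently of theta.  A face
   could only degenerate if both its first two vertices were on these axes, which
   would give p_i ^ 2 + q_j ^ 2 = 1.  Two linearly independent triples with the
   same Gram matrix differ by an orthogonal map, so the faces stay congruent,
   whereas the diagonal a_3 b_3 has length 2 theta and rules out a rigid motion. *)
Require Import Defs.
From HB Require Import structures.
From mathcomp Require Import all_boot all_order all_algebra.
From mathcomp Require Import all_classical all_reals all_analysis.
From mathcomp Require Import ring lra.
Import Order.TTheory GRing.Theory Num.Theory.
Import numFieldNormedType.Exports.

Set Implicit Arguments.
Unset Strict Implicit.
Unset Printing Implicit Defensive.

Local Open Scope classical_set_scope.
Local Open Scope ring_scope.

(** * Linear algebra: orthogonal maps obtained from Gram matrices *)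

Lemma mulmx_tr_gt0 (R : realDomainType) n (v : 'rV[R]_n) :
  v != 0 -> 0 < (v *m v^T) 0 0.
Proof.
move=> /rV0Pn[j vj]; rewrite mxE (bigD1 j) //= mxE -expr2.
apply: ltr_pwDl; first by rewrite exprn_even_gt0.
by apply: sumr_ge0 => i _; rewrite mxE -expr2 sqr_ge0.
Qed.

(** With one more column than rows, [M^T] has a nonzero left kernel; square roots allow a kernel
    vector to be normalised. *)
Lemma unit_normal (R : rcfType) m (M : 'M[R]_(m, m + 1)) :
  exists2 n : 'rV[R]_(m + 1), M *m n^T = 0 & n *m n^T = 1%:M.
Proof.
have : kermx M^T != 0.
  rewrite -mxrank_eq0 mxrank_ker mxrank_tr subn_eq0 -ltnNge.
  by rewrite (leq_ltn_trans (rank_leq_row M)) // addn1.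
case/rowV0Pn=> v /sub_kermxP vM /mulmx_tr_gt0 v0.
have vv := mx11_scalar (v *m v^T).
set a := (v *m v^T) 0 0 in v0 vv; exists ((Num.sqrt a)^-1 *: v).
  by rewrite linearZ /= -scalemxAr -[M]trmxK -trmx_mul vM trmx0 scaler0.
rewrite linearZ /= -scalemxAl -scalemxAr scalerA.
rewrite vv scale_scalar_mx -expr2 exprVn sqr_sqrtr ?ltW //.
by rewrite mulVf ?gt_eqF.
Qed.

(** Multiplying a vanishing combination of the rows by [n^T] isolates the coefficient of [n];
    freeness of [M] kills the others. *)
Lemma col_mx_normal_unit (R : fieldType) m (M : 'M[R]_(m, m + 1))
    (n : 'rV[R]_(m + 1)) :
  row_free M -> M *m n^T = 0 -> n *m n^T = 1%:M -> col_mx M n \in unitmx.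
Proof.
move=> freeM Mn nn; rewrite -row_free_unit; apply: inj_row_free => v.
rewrite -[v]hsubmxK mul_row_col => vN.
have vr : rsubmx v = 0.
  move: (congr1 (mulmx^~ n^T) vN).
  by rewrite mulmxDl -!mulmxA Mn nn mulmx0 add0r mulmx1 mul0mx.
move: vN; rewrite vr mul0mx addr0 => /eqP; rewrite mulmx_free_eq0 // => /eqP->.
exact: row_mx0.
Qed.

(* Completing both families by unit normals makes them square and invertible
   without destroying the equality of their Gram matrices. *)
Lemma gram_orthogonal (R : rcfType) m (M M' : 'M[R]_(m, m + 1)) :
  row_free M -> row_free M' -> M *m M^T = M' *m M'^T ->
  exists2 Q : 'M[R]_(m + 1), Q *m Q^T = 1%:M & M *m Q = M'.
Proof.
move=> freeM freeM' MM'.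
have [n Mn nn] := unit_normal M.
have [n' Mn' nn'] := unit_normal M'.
have N_unit := col_mx_normal_unit freeM Mn nn.
have nM (A : 'M[R]_(m, m + 1)) (u : 'rV_(m + 1)) :
    A *m u^T = 0 -> u *m A^T = 0.
  by move=> Au; rewrite -[u]trmxK -trmx_mul Au trmx0.
set N := col_mx M n in N_unit; pose N' := col_mx M' n'.
have NN' : N *m N^T = N' *m N'^T.
  by rewrite !tr_col_mx !mul_col_row MM' Mn Mn' nn nn' !nM.
(* This matrix carries [N] to [N']; by [NN'] its product with its transpose collapses to the
   identity. *)
exists (invmx N *m N').
  rewrite trmx_mul mulmxA -(mulmxA (invmx N)) -NN' mulmxA mulVmx // mul1mx.
  by rewrite trmx_inv mulmxV ?unitmx_tr.
have : N *m (invmx N *m N') = N' by rewrite mulmxA mulmxV // mul1mx.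
by rewrite {1}/N mul_col_mx => /eq_col_mx[].
Qed.

(** * Isometries, nondegenerate triangles and continuity in coordinates *)

Section Sphere.
Variable R : realType.
Implicit Types (x y : 'rV[R]_4) (T : 'I_3 -> 'rV[R]_4).

Lemma dot_mulmx x y : dot x y = (x *m y^T) 0 0.
Proof. by rewrite mxE; apply: eq_bigr => i _; rewrite mxE. Qed.

Lemma dotC x y : dot x y = dot y x.
Proof. by apply: eq_bigr => i _; rewrite mulrC. Qed.

Lemma dot_vec4 (a b c d a' b' c' d' : R) :
  dot (vec4 a b c d) (vec4 a' b' c' d') = a * a' + b * b' + c * c' + d * d'.
Proof. by rewrite /dot !big_ord_recr big_ord0 /= add0r !mxE. Qed.

Lemma dot_orthogonal (Q : 'M[R]_4) x y :
  Q *m Q^T = 1%:M -> dot (x *m Q) (y *m Q) = dot x y.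
Proof.
by move=> QQ; rewrite !dot_mulmx trmx_mul mulmxA -(mulmxA x) QQ mulmx1.
Qed.

Lemma isometry_orthogonal (Q : 'M[R]_4) :
  Q *m Q^T = 1%:M -> is_isometry (mulmx^~ Q).
Proof.
move=> QQ; split=> [|x y _ _]; last by rewrite /sdist dot_orthogonal.
apply/seteqP; split=> [_ [x Sx <-]|y Sy]; first by rewrite /S3 /= dot_orthogonal.
(* For square matrices a right inverse is a left inverse, so [Q^T] supplies the preimages needed for
   surjectivity. *)
have QQ' : Q^T *m Q = 1%:M by exact: mulmx1C.
exists (y *m Q^T); last by rewrite -mulmxA QQ' mulmx1.
by rewrite /S3 /= dot_orthogonal ?trmxK.
Qed.

Definition tri_mx T : 'M[R]_(3, 4) := \matrix_i T i.

(** A great circle spans a space of rank 2, too small to contain three independent rows. *)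
Lemma row_free_nondegenerate T : row_free (tri_mx T) -> Defs.nondegenerate T.
Proof.
rewrite -row_leq_rank => freeT [_ [A rkA ->]] TA.
have : (tri_mx T <= A)%MS.
  by apply/row_subP => i; rewrite rowK; case: (TA i).
by move/mxrankS; rewrite rkA => /(leq_trans freeT).
Qed.

Lemma congruent_gram T T' :
  row_free (tri_mx T) -> row_free (tri_mx T') ->
  (forall i j, dot (T i) (T j) = dot (T' i) (T' j)) -> congruent T T'.
Proof.
move=> freeT freeT' TT'.
have : tri_mx T *m (tri_mx T)^T = tri_mx T' *m (tri_mx T')^T.
  apply/matrixP => i j; have := TT' i j; rewrite /dot !mxE => dotE.
  by under eq_bigr do rewrite !mxE; rewrite dotE; apply: eq_bigr => k _; rewrite !mxE.
case/(@gram_orthogonal R 3) => // Q QQ TQ.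
exists (mulmx^~ Q); first exact: isometry_orthogonal.
by move=> i; rewrite -[T' i](rowK T') -/(tri_mx T') -TQ row_mul rowK.
Qed.

(** If [y != 0], the second coordinate of a vanishing combination kills the first coefficient, then
    the first coordinate kills the third, and the unit vector [T 1] kills the second. The case
    [w != 0] is symmetric. *)
Lemma row_free_planes T (x y z w c s : R) :
  T 0 = vec4 x y 0 0 -> T 1 = vec4 0 0 z w -> T 2 = vec4 c 0 s 0 ->
  S3 (T 0) -> S3 (T 1) -> c != 0 -> s != 0 -> (y != 0) || (w != 0) ->
  row_free (tri_mx T).
Proof.
rewrite /S3 /= => T0 T1 T2; rewrite T0 T1 !dot_vec4 => xy zw c0 s0 yw.
apply: inj_row_free => v vT.
have vTj (j : 'I_4) : v 0 0 * T 0 0 j + v 0 1 * T 1 0 j + v 0 2 * T 2 0 j = 0.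
  have := congr1 (fun u : 'rV_4 => u 0 j) vT.
  rewrite !mxE !big_ord_recr big_ord0 /= add0r !mxE => <-.
  (* The ordinals produced by [big_ord_recr] match 0, 1, 2 by value but not syntactically. *)
  have eq_term (i k : 'I_3) : val i = val k -> v 0 i * T i 0 j = v 0 k * T k 0 j.
    by move/val_inj->.
  by congr (_ + _ + _); apply: eq_term.
have := vTj 0; have := vTj 1; have := vTj 2; have := vTj 3.
rewrite T0 T1 T2 !mxE /= !mulr0 !addr0 !add0r => v3 v2 v1 v0.
have [v0_eq0 v1_eq0 v2_eq0] : [/\ v 0 0 = 0, v 0 1 = 0 & v 0 2 = 0].
  case/orP: yw => [y0|w0].
    have v0E : v 0 0 = 0 by apply: (mulIf y0); rewrite v1 mul0r.
    have v2E : v 0 2 = 0.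
      by apply: (mulIf c0); move: v0; rewrite v0E !mul0r add0r.
    move: v2; rewrite v2E mul0r addr0 => v2; split=> //.
    (* Writing 1 as [z * z + w * w] avoids deciding which of [z], [w] is nonzero. *)
    by rewrite -[v 0 1]mulr1 -zw !mulr0 !add0r mulrDr !mulrA v2 v3 !mul0r addr0.
  have v1E : v 0 1 = 0 by apply: (mulIf w0); rewrite v3 mul0r.
  have v2E : v 0 2 = 0.
    by apply: (mulIf s0); move: v2; rewrite v1E !mul0r add0r.
  move: v0; rewrite v2E mul0r addr0 => v0; split=> //.
  by rewrite -[v 0 0]mulr1 -xy !mulr0 !addr0 mulrDr !mulrA v0 v1 !mul0r addr0.
apply/rowP => i; rewrite mxE.
case: i => [[|[|[|//]]] hi].
- by rewrite -[RHS]v0_eq0; congr (v 0 _); exact/val_inj.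
- by rewrite -[RHS]v1_eq0; congr (v 0 _); exact/val_inj.
- by rewrite -[RHS]v2_eq0; congr (v 0 _); exact/val_inj.
Qed.

Lemma continuous_vec4 (f g h k : R -> R) (t : R) :
  {for t, continuous f} -> {for t, continuous g} ->
  {for t, continuous h} -> {for t, continuous k} ->
  {for t, continuous (fun t => vec4 (f t) (g t) (h t) (k t))}.
Proof.
move=> cf cg ch ck A [B tB BA].
have Bj (j : 'I_4) : nbhs t (fun u => B 0 j (vec4 (f u) (g u) (h u) (k u) 0 j)).
  move: (tB 0 j); rewrite mxE; under [X in nbhs t X]eq_fun do rewrite mxE.
  by case: j => [[|[|[|[|//]]]] hj] /=; [apply: cf|apply: cg|apply: ch|apply: ck].
(* A matrix neighbourhood contains a box of entrywise ones, and finitely many of these conditions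
   hold simultaneously near [t]. *)
apply: (@filterS R (nbhs t) _ _ _ _ (@filter_forall R _ _ (nbhs t) _ Bj)) => u Bu.
by apply: BA => i j; rewrite [i]ord1.
Qed.

End Sphere.

(** * Continuity of the coordinate functions *)

Lemma continuous_cst_div (R : realType) (r : R) (f : R -> R) t :
  f t != 0 -> {for t, continuous f} -> {for t, continuous (fun u => r / f u)}.
Proof.
move=> ft0 cf; apply: (@cvgM _ _ _ _ (fun=> r) (fun u => (f u)^-1)).
  exact: cvg_cst.
exact: cvgV.
Qed.

(** [Num.sqrt] is 0 on negative reals and continuous on the whole line, which covers the ends of the
    parameter interval, where the radicand may vanish. *)
Lemma continuous_sqrt_div (R : realType) (r s : R) (f : R -> R) t :
  f t != 0 -> {for t, continuous f} ->
  {for t, continuous (fun u => s * Num.sqrt (1 - r / f u ^+ 2))}.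
Proof.
move=> ft0 cf.
have cg : {for t, continuous (fun u => 1 - r / f u ^+ 2)}.
  apply: (@continuousB R R R (fun=> 1) (fun u => r / f u ^+ 2)).
    exact: cst_continuous.
  by apply: continuous_cst_div; [rewrite expf_neq0|exact: (@continuousM R R f f)].
have csqrt : {for t, continuous (fun u => Num.sqrt (1 - r / f u ^+ 2))}.
  exact: (@continuous_comp R R R _ Num.sqrt t cg (@sqrt_continuous R _)).
apply: (@cvgM _ _ _ _ (fun=> s) (fun u => Num.sqrt (1 - r / f u ^+ 2))) => //.
exact: cvg_cst.
Qed.

(** * The explicit family of octahedra and its flexibility *)

Section FlexibleOctahedron.
Variables (R : realType) (p q d e : bool -> R).
Hypothesis d_sqr : forall b, d b ^+ 2 = 1.
Hypothesis e_sqr : forall b, e b ^+ 2 = 1.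
Hypothesis pq_lt1 : forall b b', p b ^+ 2 + q b' ^+ 2 < 1.

(** The Boolean follows the convention of [vertices]: [false] for a, [true] for b, so that opposite
    vertices are treated together. *)
Definition vertex1 b t : 'rV[R]_4 :=
  vec4 (p b / cos t) (d b * Num.sqrt (1 - p b ^+ 2 / cos t ^+ 2)) 0 0.

Definition vertex2 b t : 'rV[R]_4 :=
  vec4 0 0 (q b / sin t) (e b * Num.sqrt (1 - q b ^+ 2 / sin t ^+ 2)).

Definition vertex3 (b : bool) t : 'rV[R]_4 :=
  vec4 (cos t) 0 (if b then - sin t else sin t) 0.

Definition flexible_octahedron t : vertices R :=
  octahedron (vertex1 false t) (vertex1 true t) (vertex2 false t)
    (vertex2 true t) (vertex3 false t) (vertex3 true t).

Lemma flexible_octahedronE t i b : flexible_octahedron t i b =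
  [:: vertex1 b t; vertex2 b t; vertex3 b t]`_i.
Proof. by case: b; case: i => [[|[|[|]]]]. Qed.

(** The denominators are nonzero and the radicands nonnegative; equality is allowed, so that the
    endpoints of the interval qualify. *)
Definition admissible t := [/\ 0 < cos t, 0 < sin t,
  forall b, p b ^+ 2 <= cos t ^+ 2 & forall b, q b ^+ 2 <= sin t ^+ 2].

Section Admissible.
Variable t : R.
Hypothesis adm_t : admissible t.

Let c0 : cos t != 0. Proof. by case: adm_t => /lt0r_neq0. Qed.
Let s0 : sin t != 0. Proof. by case: adm_t => _ /lt0r_neq0. Qed.

Lemma vertex1_S3 b : dot (vertex1 b t) (vertex1 b t) = 1.
Proof.
have [cp _ pc _] := adm_t.
rewrite dot_vec4 -!expr2 [(d b * _) ^+ 2]exprMn d_sqr sqr_sqrtr; first by field.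
by rewrite subr_ge0 ler_pdivrMr ?mul1r ?exprn_gt0.
Qed.

Lemma vertex2_S3 b : dot (vertex2 b t) (vertex2 b t) = 1.
Proof.
have [_ sp _ qs] := adm_t.
rewrite dot_vec4 -!expr2 [(e b * _) ^+ 2]exprMn e_sqr sqr_sqrtr; first by field.
by rewrite subr_ge0 ler_pdivrMr ?mul1r ?exprn_gt0.
Qed.

Lemma vertex3_S3 b : dot (vertex3 b t) (vertex3 b t) = 1.
Proof.
by rewrite dot_vec4 !mulr0 !addr0 -(cos2Dsin2 t) !expr2; case: b; rewrite ?mulrNN.
Qed.

Lemma dot_vertex12 b b' : dot (vertex1 b t) (vertex2 b' t) = 0.
Proof. by rewrite dot_vec4; ring. Qed.

Lemma dot_vertex13 b b' : dot (vertex1 b t) (vertex3 b' t) = p b.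
Proof. by rewrite dot_vec4; field. Qed.

Lemma dot_vertex23 b b' :
  dot (vertex2 b t) (vertex3 b' t) = if b' then - q b else q b.
Proof. by rewrite dot_vec4; case: b'; field. Qed.

Lemma row_free_face s : row_free (tri_mx (face (flexible_octahedron t) s)).
Proof.
have [cp sp pc qs] := adm_t.
set T := face _ s.
have T0 : T 0 = vertex1 (s 0) t by rewrite /T /face flexible_octahedronE.
have T1 : T 1 = vertex2 (s 1) t by rewrite /T /face flexible_octahedronE.
have T2 : T 2 = vertex3 (s 2) t by rewrite /T /face flexible_octahedronE.
apply: (row_free_planes T0 T1 T2) => //.
- by rewrite T0; apply: vertex1_S3.
- by rewrite T1; apply: vertex2_S3.
- by case: (s 2); rewrite ?oppr_eq0.
have neq0 (u x c : R) : u ^+ 2 = 1 -> x < c -> 0 < c -> u * Num.sqrt (1 - x / c) != 0.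
  move=> u1 xc c_gt0; rewrite mulf_neq0 //.
    by rewrite -sqrf_eq0 u1 oner_eq0.
  by rewrite gt_eqF // sqrtr_gt0 subr_gt0 ltr_pdivrMr ?mul1r.
(* If both failed, [p (s 0) ^+ 2 + q (s 1) ^+ 2] would be at least 1. So at least one of the two
   radicands is positive. *)
have : (p (s 0) ^+ 2 < cos t ^+ 2) || (q (s 1) ^+ 2 < sin t ^+ 2).
  rewrite -implyNb -leNgt; apply/implyP => cp'.
  have := pq_lt1 (s 0) (s 1); rewrite -(cos2Dsin2 t); lra.
by case/orP => lt_; apply/orP; [left|right]; apply: neq0; rewrite ?exprn_gt0.
Qed.

End Admissible.

Lemma flexible_octahedron_S3 t i b :
  admissible t -> S3 (flexible_octahedron t i b).
Proof.
move=> adm_t; rewrite flexible_octahedronE.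
by case: i => [[|[|[|//]]] hi] /=;
  [apply: vertex1_S3|apply: vertex2_S3|apply: vertex3_S3].
Qed.

Lemma dot_face t u s i j : admissible t -> admissible u ->
  dot (face (flexible_octahedron t) s i) (face (flexible_octahedron t) s j) =
  dot (face (flexible_octahedron u) s i) (face (flexible_octahedron u) s j).
Proof.
move=> adm_t adm_u.
(* By symmetry, only the unit diagonal and the pairs 12, 13, 23 remain. *)
wlog le_ij : i j / (i <= j)%N.
  move=> wl; have [/wl//|/ltnW/wl ji] := leqP i j.
  by rewrite dotC [RHS]dotC.
have [<-|neq_ij] := eqVneq i j.
  by rewrite !(flexible_octahedron_S3 _ (s i)).
rewrite /face !flexible_octahedronE.
case: i le_ij neq_ij => [[|[|[|//]]] hi]; case: j => [[|[|[|//]]] hj] //= _ _;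
  by rewrite ?dot_vertex12 ?dot_vertex13 ?dot_vertex23.
Qed.

Lemma flexible_octahedron_congruent t u s : admissible t -> admissible u ->
  congruent (face (flexible_octahedron t) s) (face (flexible_octahedron u) s).
Proof.
move=> adm_t adm_u; apply: congruent_gram; [exact: row_free_face..|].
by move=> i j; apply: dot_face.
Qed.

Lemma flexible_octahedron_octahedron t :
  admissible t -> is_octahedron (flexible_octahedron t).
Proof.
move=> adm_t; split=> [i b|s]; first exact: flexible_octahedron_S3.
exact/row_free_nondegenerate/row_free_face.
Qed.

Lemma continuous_vertex1 b t :
  cos t != 0 -> {for t, continuous (vertex1 b)}.
Proof.
move=> c0; apply: continuous_vec4.
- by apply: continuous_cst_div => //; exact: continuous_cos.
- by apply: continuous_sqrt_div => //; exact: continuous_cos.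
- exact: cst_continuous.
- exact: cst_continuous.
Qed.

Lemma continuous_vertex2 b t :
  sin t != 0 -> {for t, continuous (vertex2 b)}.
Proof.
move=> s0; apply: continuous_vec4.
- exact: cst_continuous.
- exact: cst_continuous.
- by apply: continuous_cst_div => //; exact: continuous_sin.
- by apply: continuous_sqrt_div => //; exact: continuous_sin.
Qed.

Lemma continuous_vertex3 b t : {for t, continuous (vertex3 b)}.
Proof.
apply: continuous_vec4.
- exact: continuous_cos.
- exact: cst_continuous.
- by case: b; [apply: cvgN|]; exact: continuous_sin.
- exact: cst_continuous.
Qed.

Lemma continuous_flexible_octahedron t i b :
  admissible t -> {for t, continuous (fun t => flexible_octahedron t i b)}.
Proof.
move=> [/lt0r_neq0 c0 /lt0r_neq0 s0 _ _].
rewrite (_ : (fun t => _) =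
    (fun t => [:: vertex1 b t; vertex2 b t; vertex3 b t]`_i)); last first.
  by apply/funext => u; rewrite flexible_octahedronE.
case: i => [[|[|[|//]]] hi] /=; [exact: continuous_vertex1|exact: continuous_vertex2|].
exact: continuous_vertex3.
Qed.

(** The scalar product is [cos t ^+ 2 - sin t ^+ 2], the cosine of the doubled angle, and the bounds
    put that angle in the range where [acos] inverts [cos]. *)
Lemma sdist_diagonal3 t : 0 <= t <= pi / 2 ->
  sdist (flexible_octahedron t 2 false) (flexible_octahedron t 2 true) = t *+ 2.
Proof.
move=> ht; rewrite !flexible_octahedronE /sdist dot_vec4.
rewrite (_ : _ + _ = cos (t *+ 2)); last by rewrite cos_mulr2n; have := cos2Dsin2 t; lra.
by rewrite cosK // in_itv /=; lra.
Qed.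

Lemma flexible_octahedron_flexion (I : set R) t0 t1 :
  is_interval I -> (forall t, I t -> admissible t /\ 0 <= t <= pi / 2) ->
  I t0 -> I t1 -> t0 != t1 -> is_flexion I flexible_octahedron.
Proof.
move=> itvI IP It0 It1 neq01; split=> //.
- by move=> t /IP[adm_t _]; exact: flexible_octahedron_octahedron.
- move=> i b; apply: continuous_in_subspaceT => t /set_mem/IP[adm_t _].
  exact: continuous_flexible_octahedron.
- move=> s t u /IP[adm_t _] /IP[adm_u _]; exact: flexible_octahedron_congruent.
case=> u [g [Iu [isog _] gP]].
(* An isometry preserves the diagonal a_3 b_3, of length [t *+ 2]; a rigid family would thus reduce
   [I] to one point, against [t0 != t1]. *)
have tE t : I t -> t = u.
  move=> It; have [[adm_t ht] [adm_u hu]] := (IP _ It, IP _ Iu).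
  have := (isog _ It).2 _ _ (flexible_octahedron_S3 2 false adm_u)
    (flexible_octahedron_S3 2 true adm_u).
  by rewrite -(gP _ It) -(gP _ It) !sdist_diagonal3 //; lra.
by move/eqP: neq01; apply; rewrite (tE t0) // (tE t1).
Qed.

End FlexibleOctahedron.

(** * Bounds on the parameter interval *)

Lemma sqr_max_norm (R : realDomainType) (x y : R) :
  Num.max `|x| `|y| ^+ 2 = Num.max (x ^+ 2) (y ^+ 2).
Proof.
rewrite -[x ^+ 2]real_normK ?num_real // -[y ^+ 2]real_normK ?num_real //.
by rewrite !maxEle ler_sqr ?nnegrE ?normr_ge0 //; case: ifP.
Qed.

Section Trigonometry.
Variable R : realType.
Implicit Types x y : R.

Lemma ler_cos : {in `[0, pi] &, {mono @cos R : x y /~ y <= x}}.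
Proof. by move=> x y ? ?; rewrite !leNgt ltr_cos. Qed.

Lemma ler_sin : {in `[- (pi / 2), pi / 2] &, {mono @sin R : x y / x <= y}}.
Proof. by move=> x y ? ?; rewrite !leNgt ltr_sin. Qed.

Lemma asin_ge0 x : 0 <= x <= 1 -> 0 <= asin x.
Proof.
move=> x01; have x1 : -1 <= x <= 1 by lra.
have := pi_gt0 R => pi0.
rewrite -ler_sin ?in_itv /= ?asin_geNpi2 ?asin_lepi2 //; last lra.
by rewrite sin0 asinK ?in_itv //; lra.
Qed.

Lemma acos_le_pihalf x : 0 <= x <= 1 -> acos x <= pi / 2.
Proof.
move=> x01; have x1 : -1 <= x <= 1 by lra.
have := pi_gt0 R => pi0.
rewrite -ler_cos ?in_itv /= ?acos_ge0 ?acos_lepi //; last lra.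
by rewrite cos_pihalf acosK ?in_itv //; lra.
Qed.

(** Both angles lie where the sine is increasing, and their sines are [x] and the square root of
    [1 - y ^+ 2]. This makes the parameter interval nontrivial. *)
Lemma asin_lt_acos x y : 0 <= x -> 0 <= y -> x ^+ 2 + y ^+ 2 < 1 ->
  asin x < acos y.
Proof.
move=> x0 y0 xy; have pi0 := pi_gt0 R.
have x1 : -1 <= x <= 1 by nra.
have y1 : -1 <= y <= 1 by nra.
have acos0 := acos_ge0 y1.
have acos_pi : acos y <= pi / 2 by apply: acos_le_pihalf; lra.
rewrite -ltr_sin ?in_itv /= ?asin_geNpi2 ?asin_lepi2 ?acos_pi ?andbT //; last lra.
by rewrite asinK ?in_itv // sin_acos // -(ger0_norm x0) -sqrtr_sqr ltr_sqrt; nra.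
Qed.

End Trigonometry.

Theorem proposition2p1 (R : realType)
    (p1 p2 q1 q2 delta1 delta2 epsilon1 epsilon2 : R)
    (hpq : Num.max (p1 ^+ 2) (p2 ^+ 2) + Num.max (q1 ^+ 2) (q2 ^+ 2) < 1)
    (hdelta1 : delta1 = -1 \/ delta1 = 1)
    (hdelta2 : delta2 = -1 \/ delta2 = 1)
    (hepsilon1 : epsilon1 = -1 \/ epsilon1 = 1)
    (hepsilon2 : epsilon2 = -1 \/ epsilon2 = 1) :
  let theta_min := asin (Num.max `|q1| `|q2|) in
  let theta_max := acos (Num.max `|p1| `|p2|) in
  is_flexion
    [set theta : R | theta_min <= theta <= theta_max /\ 0 < theta < pi / 2]
    (fun theta => octahedron
      (* a1 *)
      (vec4 (p1 / cos theta)
            (delta1 * Num.sqrt (1 - p1 ^+ 2 / cos theta ^+ 2)) 0 0)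
      (* b1 *)
      (vec4 (p2 / cos theta)
            (delta2 * Num.sqrt (1 - p2 ^+ 2 / cos theta ^+ 2)) 0 0)
      (* a2 *)
      (vec4 0 0 (q1 / sin theta)
            (epsilon1 * Num.sqrt (1 - q1 ^+ 2 / sin theta ^+ 2)))
      (* b2 *)
      (vec4 0 0 (q2 / sin theta)
            (epsilon2 * Num.sqrt (1 - q2 ^+ 2 / sin theta ^+ 2)))
      (* a3 *)
      (vec4 (cos theta) 0 (sin theta) 0)
      (* b3 *)
      (vec4 (cos theta) 0 (- sin theta) 0)).
Proof.
move=> theta_min theta_max.
(* Packing each pair of parameters as a function on [bool] makes the stated octahedron an instance
   of [flexible_octahedron] by computation. *)
pose select (x y : R) (b : bool) := if b then y else x.
have sign_sqr (u v : R) b : u = -1 \/ u = 1 -> v = -1 \/ v = 1 -> select u v b ^+ 2 = 1.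
  by case: b => -[->|->] [->|->]; rewrite ?sqrrN expr1n.
move: hpq; rewrite -!sqr_max_norm.
set mp := Num.max `|p1| `|p2| in theta_max *.
set mq := Num.max `|q1| `|q2| in theta_min * => hm.
have mp0 : 0 <= mp by rewrite le_max normr_ge0.
have mq0 : 0 <= mq by rewrite le_max normr_ge0.
have p_le b : select p1 p2 b ^+ 2 <= mp ^+ 2.
  by rewrite sqr_max_norm le_max; case: b; rewrite lexx ?orbT.
have q_le b : select q1 q2 b ^+ 2 <= mq ^+ 2.
  by rewrite sqr_max_norm le_max; case: b; rewrite lexx ?orbT.
have mp1 : -1 <= mp <= 1 by nra.
have mq1 : -1 <= mq <= 1 by nra.
have min_lt_max : theta_min < theta_max by apply: asin_lt_acos => //; rewrite addrC.
have min0 : 0 <= theta_min by apply: asin_ge0; lra.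
have max_pi : theta_max <= pi / 2 by apply: acos_le_pihalf; lra.
have pi0 := pi_gt0 R.
(* The points at one and two thirds of the interval are distinct and interior, hence strictly
   between 0 and [pi / 2] even if [theta_min] is 0 or [theta_max] is [pi / 2]. *)
apply: (@flexible_octahedron_flexion R (select p1 p2) (select q1 q2)
  (select delta1 delta2) (select epsilon1 epsilon2) _ _ _ _
  ((2 * theta_min + theta_max) / 3) ((theta_min + 2 * theta_max) / 3)).
- by move=> b; exact: sign_sqr.
- by move=> b; exact: sign_sqr.
- by move=> b b'; apply: le_lt_trans hm; exact: lerD.
- by move=> x y /= Ix Iy z xzy; lra.
- move=> t /= [tmm tpi]; split; last lra.
  have [min_le le_max] : asin mq <= t /\ t <= acos mp by exact/andP.
  have sin_t : 0 < sin t by apply: sin_gt0_pihalf.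
  have cos_t : 0 < cos t by apply: cos_gt0_pihalf; lra.
  (* Since [mp] is the cosine of [theta_max] and [mq] the sine of [theta_min], monotonicity turns
     the bounds on [t] into bounds on [cos t] and [sin t]. *)
  have mp_le : mp <= cos t.
    by rewrite -(@acosK R mp) ?in_itv // ler_cos ?in_itv /= ?acos_ge0 ?acos_lepi //; lra.
  have mq_le : mq <= sin t.
    by rewrite -(@asinK R mq) ?in_itv // ler_sin ?in_itv /= ?asin_geNpi2 ?asin_lepi2 //; lra.
  split=> // b.
    by apply: le_trans (p_le b) _; rewrite ler_sqr ?nnegrE // ltW.
  by apply: le_trans (q_le b) _; rewrite ler_sqr ?nnegrE // ltW.
- by rewrite /=; lra.
- by rewrite /=; lra.
- by apply/eqP; lra.
Qed.
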